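(* For any integer $\alpha>1$, the single-variable optimization problem $$\min_{x}\ V\sum_{m=1}^M\rho_\alpha\big(q_m,\sigma_{m,t}(x)\big)+Q_t\frac{d\sigma_n^2}{h_{\min,t}^2}\Big(\frac1x-\frac1{x_{\max}}\Big)+\frac12\Big(\frac{d\sigma_n^2}{h_{\min,t}^2}\Big)^2\Big(\frac1x-\frac1{x_{\max}}\Big)^2\quad\text{s.t. } 0<x\le x_{\max}$$ is convex; that is, its objective function is a convex function of $x$ on the (convex) feasible set $(0,x_{\max}]$.
   Context: Here $M,d\ge1$ are integers; $V,\sigma_n,G,x_{\max},h_{\min,t}>0$, $Q_t\ge0$, $B_m>0$ and $q_m\in(0,1]$ ($m=1,\dots,M$) are fixed real constants. The effective noise multiplier as a function of $x$ is $$\sigma_{m,t}(x)=\frac{MB_m\sigma_n}{\sqrt{2x}\,G\,h_{\min,t}}.$$ For an integer $\alpha>1$, $q\in(0,1]$ and $\sigma>0$, $$\rho_\alpha(q,\sigma)=\frac{1}{\alpha-1}\ln\Big[\sum_{k=0}^{\alpha}\binom{\alpha}{k}(1-q)^{\alpha-k}q^k\exp\Big(\frac{k^2-k}{2\sigma^2}\Big)\Big]$$ (with the convention $0^0=1$). *)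

(* Defs.v *)
From mathcomp Require Import all_boot all_order all_algebra.
From mathcomp Require Import all_classical all_reals all_analysis.
Set Implicit Arguments.
Unset Strict Implicit.
Unset Printing Implicit Defensive.
Import Order.TTheory GRing.Theory Num.Theory.
Local Open Scope ring_scope.

(* [0 ^+ 0 = 1], so the convention 0^0 = 1 needed at q = 1 (k = alpha) holds. *)
Definition rho (R : realType) (alpha : nat) (q sigma : R) : R :=
  (alpha%:R - 1)^-1 *
  ln (\sum_(0 <= k < alpha.+1)
        'C(alpha, k)%:R * (1 - q) ^+ (alpha - k) * q ^+ k *
        expR ((k%:R ^+ 2 - k%:R) / (2 * sigma ^+ 2))).

Definition noise_multiplier (R : realType) (M : nat) (Bm sigma_n G hmin x : R)
    : R :=
  (M%:R * Bm * sigma_n) / (Num.sqrt (2 * x) * G * hmin).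

(* Main.v *)
(* The quantity 1 / (2 sigma(x)^2) is linear in x, so each Renyi term is a
   positive multiple of a log-sum-exp of linear functions of x, hence convex.
   The function 1/x - 1/xmax is convex and nonnegative on ]0, xmax], so its
   square is convex as well. *)
Require Import Defs.
From mathcomp Require Import all_boot all_order all_algebra.
From mathcomp Require Import all_classical all_reals all_analysis.
From mathcomp Require Import ring.
Set Implicit Arguments.
Unset Strict Implicit.
Unset Printing Implicit Defensive.
Import Order.TTheory GRing.Theory Num.Theory.
Local Open Scope ring_scope.

Lemma conv_realE (R : numDomainType) (t : {i01 R}) (a b : R^o) :
  conv t a b = t%:num * a + (1 - t%:num) * b.
Proof. by []. Qed.

Section convex_function_closure.
Variables (R : numFieldType) (E : lmodType R) (D : set (convex_lmodType E)).
Implicit Types f g : convex_lmodType E -> R^o.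

Lemma convex_functionD f g : convex_function D f -> convex_function D g ->
  convex_function D (fun x => f x + g x).
Proof.
move=> cf cg t x y Dx Dy; rewrite conv_realE !mulrDr addrACA.
exact: lerD (cf t x y Dx Dy) (cg t x y Dx Dy).
Qed.

Lemma convex_functionZ (c : R) f : 0 <= c -> convex_function D f ->
  convex_function D (fun x => c * f x).
Proof.
move=> c0 cf t x y Dx Dy; rewrite conv_realE !(mulrCA _ c) -mulrDr.
exact: ler_wpM2l c0 _ _ (cf t x y Dx Dy).
Qed.

Lemma convex_function_cst (c : R) : convex_function D (fun=> c : R^o).
Proof. by move=> t x y _ _; rewrite convmm. Qed.

Lemma convex_function_sum (I : Type) (r : seq I)
    (f : I -> convex_lmodType E -> R^o) :
  (forall i, convex_function D (f i)) ->
  convex_function D (fun x => \sum_(i <- r) f i x : R^o).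
Proof.
move=> cf t x y Dx Dy; rewrite conv_realE !mulr_sumr -big_split/=.
by apply: ler_sum => i _; exact: cf.
Qed.

(** Squaring is increasing on nonnegative values, so the bound on [f] at the interpolated point,
    which stays in [D], can be squared. What remains is convexity of the square itself, whose gap is
    [s * (1 - s) * (a - b) ^+ 2]. *)
Lemma convex_function_sqr f : convex_function D f ->
  convex_set D -> {in D, forall x, 0 <= f x} ->
  convex_function D (fun x => f x ^+ 2).
Proof.
move=> cf cD f0 t x y Dx Dy.
have fxy : f (conv t x y) ^+ 2 <= (conv t (f x) (f y)) ^+ 2.
  by rewrite ler_pXn2r ?nnegrE ?(le_trans _ (cf t x y Dx Dy)) ?f0 ?cD ?cf.
apply: le_trans fxy _; rewrite !conv_realE -subr_ge0.
have s0 : 0 <= t%:num * (1 - t%:num) by rewrite mulr_ge0// subr_ge0 le1.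
set s := t%:num in s0 *; set a := f x; set b := f y.
have -> : s * a ^+ 2 + (1 - s) * b ^+ 2 - (s * a + (1 - s) * b) ^+ 2
    = s * (1 - s) * (a - b) ^+ 2 by ring.
(* In a general [numFieldType] a square is known to be nonnegative only for real elements;
   nonnegativity of [f] makes [a] and [b] real. *)
have abr : a - b \is Num.real by rewrite realB// ger0_real ?f0.
by rewrite mulr_ge0// -realEsqr.
Qed.

End convex_function_closure.

Section convex_real.
Variable R : realType.
Implicit Types D : set (convex_lmodType R^o).

Lemma convex_set_itv (i : interval R) :
  convex_set ([set` i]%classic : set (convex_lmodType R^o)).
Proof.
move=> x y t /[!inE]/= xi yi.
wlog xy : t x y xi yi / x <= y.
  move=> h; have [/h|/ltW yx] := leP x y; first exact.
  by rewrite convC; exact: h.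
exact: (interval_is_interval xi yi) (convR_itv t xy).
Qed.

(** After multiplication by the positive interpolated point, the convexity gap is
    [s * (1 - s) * (x - y) ^+ 2 / (x * y)]. *)
Lemma convex_inv D : (D `<=` [set x : R | 0 < x])%classic ->
  convex_function D (fun x : R => x^-1 : R^o).
Proof.
move=> D0 t x y /[!inE] /D0/= x0 /D0/= y0.
have xy0 := convR_gt0 t x0 y0.
rewrite -[leLHS]div1r ler_pdivrMr// !conv_realE.
rewrite -subr_ge0.
have s0 : 0 <= t%:num * (1 - t%:num) by rewrite mulr_ge0// subr_ge0 le1.
set s := t%:num in s0 *.
have -> : (s * x^-1 + (1 - s) * y^-1) * (s * x + (1 - s) * y) - 1
    = s * (1 - s) * (x - y) ^+ 2 / (x * y).
  by field; rewrite !gt_eqF.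
by rewrite divr_ge0 ?(mulr_ge0 s0 (sqr_ge0 _))// ltW// mulr_gt0.
Qed.

(** One positive coefficient keeps the sum positive, so [ln] and [expR] are mutually inverse on it.
    The other coefficients may vanish, as happens for the binomial weights at [q = 1]. *)
Lemma convex_log_sum_exp D (n : nat) (a w : nat -> R) :
  (forall k, (k < n)%N -> 0 <= a k) ->
  (exists2 k, (k < n)%N & 0 < a k) ->
  convex_function D
    (fun x : R => ln (\sum_(0 <= k < n) a k * expR (w k * x)) : R^o).
Proof.
move=> a_ge0 [j jn aj_gt0] t x y _ _.
set S := fun x : R => \sum_(0 <= k < n) a k * expR (w k * x).
have S_gt0 z : 0 < S z.
  rewrite /S big_mkord (bigD1 (Ordinal jn))//= ltr_pwDl ?mulr_gt0 ?expR_gt0//.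
  by rewrite sumr_ge0// => i _; rewrite mulr_ge0 ?expR_ge0 ?a_ge0.
rewrite -/(S _) -/(S x) -/(S y).
set lx : R := ln (S x); set ly : R := ln (S y).
have lSx : expR lx = S x by rewrite lnK ?posrE.
have lSy : expR ly = S y by rewrite lnK ?posrE.
set l := conv t (lx : R^o) ly.
rewrite -[leRHS]expRK ler_ln ?posrE ?expR_gt0//.
rewrite -[leRHS]mul1r -ler_pdivrMr ?expR_gt0// -expRN mulr_suml.
(* Dividing by the interpolated value exp l reduces the claim to the convexity
   of exp, applied termwise to the normalised weights. *)
have -> : 1 = \sum_(0 <= k < n) a k *
    (t%:num * expR (w k * x - lx) + (1 - t%:num) * expR (w k * y - ly)).
  under eq_bigr do rewrite mulrDr !expRB lSx lSy.
  rewrite big_split/=.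
  transitivity (t%:num * (S x / S x) + (1 - t%:num) * (S y / S y)).
    by rewrite !divff ?gt_eqF// !mulr1 addrC subrK.
  by congr (_ + _); rewrite {1}/S mulr_suml mulr_sumr; apply: eq_bigr => k _; ring.
rewrite !big_mkord; apply: ler_sum => k _.
rewrite -mulrA ler_wpM2l ?a_ge0// -expRD.
apply: le_trans (convex_expR t (w k * x - lx : R^o) (w k * y - ly)).
(* The exponents are affine in the endpoints and [l] interpolates [lx] and [ly] with the same
   weights, so the two sides are equal. *)
rewrite ler_expR /l [conv t x y]conv_realE !conv_realE.
by rewrite le_eqVlt; apply/orP; left; apply/eqP; ring.
Qed.

(** Squaring removes the root, and inverting moves [x] to the numerator: this is the linearity in
    [x] of the Renyi exponents. *)
Lemma half_inv_noise_multiplier_sqr (M : nat) (b s g h x : R) : 0 <= x ->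
  (2 * noise_multiplier M b s g h x ^+ 2)^-1 =
  (g * h / (M%:R * b * s)) ^+ 2 * x.
Proof.
move=> x0; rewrite /noise_multiplier.
move: (M%:R * b * s) => c.
rewrite !expr_div_n !exprMn sqr_sqrtr ?mulr_ge0// invfM invf_div.
(* For [c = 0] both sides are 0, by the convention that the inverse of 0 is 0. *)
have [->|c0] := eqVneq c 0; last by field.
by rewrite !expr0n/= invr0 !mulr0 mul0r.
Qed.

End convex_real.

Lemma convex_rho_noise_multiplier (R : realType) (M alpha : nat)
    (b s g h q : R) (D : set (convex_lmodType R^o)) :
  (1 < alpha)%N -> 0 < q <= 1 -> convex_set D -> (D `<=` [set x : R | 0 < x])%classic ->
  convex_function D
    (fun x : R => rho alpha q (noise_multiplier M b s g h x) : R^o).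
Proof.
move=> alpha1 /andP[q0 q1] cD D0.
pose c := (g * h / (M%:R * b * s)) ^+ 2.
pose a k : R := 'C(alpha, k)%:R * (1 - q) ^+ (alpha - k) * q ^+ k.
pose w k : R := (k%:R ^+ 2 - k%:R) * c.
have rhoE x : D x -> rho alpha q (noise_multiplier M b s g h x) =
    (alpha%:R - 1)^-1 * ln (\sum_(0 <= k < alpha.+1) a k * expR (w k * x)).
  move=> /D0/ltW x0; congr (_ * ln _); apply: eq_bigr => k _.
  by rewrite half_inv_noise_multiplier_sqr// mulrA.
have cL : convex_function D (fun x : R =>
    (alpha%:R - 1)^-1 * ln (\sum_(0 <= k < alpha.+1) a k * expR (w k * x)) : R^o).
  apply: convex_functionZ; first by rewrite invr_ge0 subr_ge0 ler1n ltnW.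
  apply: convex_log_sum_exp => [k _|].
    by rewrite !mulr_ge0 ?exprn_ge0 ?subr_ge0// ltW.
  (* The top term has coefficient [q ^+ alpha], positive even at [q = 1] because [0 ^+ 0 = 1]. *)
  by exists alpha => //; rewrite /a binn subnn expr0 !mul1r exprn_gt0.
(* The log-sum-exp form [rhoE] is available only on [D], so it is applied at both endpoints and at
   the interpolated point, which lies in [D] by convexity. *)
move=> t x y Dx Dy; have Dxy := cD x y t Dx Dy.
move: (cL t x y Dx Dy); move: Dx Dy Dxy => /set_mem Dx /set_mem Dy /set_mem Dxy.
by rewrite (rhoE _ Dx) (rhoE _ Dy) (rhoE _ Dxy).
Qed.

Theorem proposition1 (R : realType) (M d : nat)
    (V sigma_n G xmax hmin Q : R) (B q : 'I_M -> R)
    (hM : (1 <= M)%N) (hd : (1 <= d)%N)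
    (hV : 0 < V) (hsigma : 0 < sigma_n) (hG : 0 < G) (hxmax : 0 < xmax)
    (hhmin : 0 < hmin) (hQ : 0 <= Q)
    (hB : forall m, 0 < B m) (hq : forall m, 0 < q m <= 1)
    (alpha : nat) (halpha : (1 < alpha)%N) :
  convex_set (`]0, xmax]%classic : set R^o) /\
  convex_function (`]0, xmax]%classic : set R^o)
    (fun x : R =>
       V * (\sum_(m < M)
              rho alpha (q m) (noise_multiplier M (B m) sigma_n G hmin x))
       + Q * (d%:R * sigma_n ^+ 2 / hmin ^+ 2) * (x^-1 - xmax^-1)
       + 2^-1 * (d%:R * sigma_n ^+ 2 / hmin ^+ 2) ^+ 2
           * (x^-1 - xmax^-1) ^+ 2).
Proof.
have cD : convex_set (`]0, xmax]%classic : set (convex_lmodType R^o)).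
  exact: convex_set_itv.
have D0 : (`]0, xmax]%classic `<=` [set x : R | 0 < x])%classic.
  by move=> x /=; rewrite in_itv/= => /andP[].
have cinv : convex_function (`]0, xmax]%classic : set (convex_lmodType R^o))
    (fun x : R => x^-1 - xmax^-1 : R^o).
  by apply: convex_functionD; [exact: convex_inv | exact: convex_function_cst].
have c0 : 0 <= d%:R * sigma_n ^+ 2 / hmin ^+ 2.
  by rewrite divr_ge0 ?sqr_ge0// mulr_ge0 ?sqr_ge0.
split=> //; apply: convex_functionD; [apply: convex_functionD|].
- apply: convex_functionZ; first exact: ltW.
  apply: convex_function_sum => m.
  exact: convex_rho_noise_multiplier.
- by apply: convex_functionZ => //; rewrite mulr_ge0.
- apply: convex_functionZ; first by rewrite mulr_ge0 ?sqr_ge0 ?invr_ge0.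
  (* The constraint [x <= xmax] enters here: inversion reverses it, making the base of the square
     nonnegative. *)
  apply: convex_function_sqr => // x; rewrite inE/= in_itv/= => /andP[x0 xm].
  by rewrite subr_ge0 lef_pV2.
Qed.
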